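(* Let $(X,d)$ be an unbounded metric space, let $p\in X$, and let $\tilde r=(r_n)_{n\in\mathbb N}$ be a scaling sequence. Let $\tilde X^0_{\infty,\tilde r}$ be the set of all sequences $\tilde z=(z_n)_{n\in\mathbb N}$ of points of $X$ with $\lim_{n\to\infty} d(z_n,p)/r_n=0$, and let $\tilde X_\infty$ be the set of all sequences $(x_n)_{n\in\mathbb N}$ of points of $X$ with $\lim_{n\to\infty} d(x_n,p)=\infty$. Then the following statements hold. (i) $\tilde X^0_{\infty,\tilde r}\subseteq Seq(X,\tilde r)$, and $\tilde x\in\tilde X^0_{\infty,\tilde r}$ for every bounded sequence $\tilde x$ of points of $X$. (ii) The set $\tilde X^0_{\infty,\tilde r}\cap\tilde X_\infty$ is nonempty. (iii) If $\tilde z\in\tilde X^0_{\infty,\tilde r}$, $\tilde y$ is a sequence of points of $X$, and $d_{\tilde r}(\tilde z,\tilde y)=0$, then $\tilde y\in\tilde X^0_{\infty,\tilde r}$. (iv) If $F$ is a self-stable subset of $Seq(X,\tilde r)$, then $\tilde X^0_{\infty,\tilde r}\cup F$ is also a self-stable subset of $Seq(X,\tilde r)$. (v) The set $\tilde X^0_{\infty,\tilde r}$ is self-stable. (vi) The inclusion $\tilde X^0_{\infty,\tilde r}\subseteq\tilde X_{\infty,\tilde r}$ holds for every maximal self-stable subset $\tilde X_{\infty,\tilde r}$ of $Seq(X,\tilde r)$. (vii) Let $\tilde z\in\tilde X^0_{\infty,\tilde r}$ and let $\tilde x$ be a sequence of points of $X$. Then $\tilde x\in Seq(X,\tilde r)$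 if and only if $\tilde x$ and $\tilde z$ are mutually stable with respect to $\tilde r$. (viii) For every $\tilde x\in Seq(X,\tilde r)$ and every $\tilde z\in\tilde X^0_{\infty,\tilde r}$ we have $\tilde d_{\tilde r}(\tilde x)=d_{\tilde r}(\tilde x,\tilde z)$. (ix) The set $\tilde X^0_{\infty,\tilde r}$ is a point of every asymptotically pretangent space $\Omega^X_{\infty,\tilde r}$ to $X$ with respect to $\tilde r$. (x) For every subsequence $\tilde r'=(r_{n_k})_{k\in\mathbb N}$ of $\tilde r$ (with $n_1<n_2<\dots$), the equality $\varphi_{\tilde r'}(\tilde X^0_{\infty,\tilde r})=\tilde X^0_{\infty,\tilde r'}$ holds, where $\varphi_{\tilde r'}((x_n)_{n\in\mathbb N})=(x_{n_k})_{k\in\mathbb N}$.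
   Context: A scaling sequence is a sequence $\tilde r=(r_n)_{n\in\mathbb N}$ of positive real numbers with $\lim_{n\to\infty} r_n=\infty$. $Seq(X,\tilde r)$ is the set of all sequences $\tilde x=(x_n)_{n\in\mathbb N}$ of points of $X$ for which the limit $\tilde d_{\tilde r}(\tilde x)=\lim_{n\to\infty} d(x_n,p)/r_n$ exists and is finite (independent of the choice of $p$). Two sequences $\tilde x,\tilde y$ of points of $X$ are mutually stable with respect to $\tilde r$ if the limit $d_{\tilde r}(\tilde x,\tilde y)=\lim_{n\to\infty} d(x_n,y_n)/r_n$ exists and is finite; writing $d_{\tilde r}(\tilde x,\tilde y)=c$ includes the existence of this limit. A set $F\subseteq Seq(X,\tilde r)$ is self-stable if any two of its elements are mutually stable, and maximal self-stable if it is self-stable and every $\tilde y\in Seq(X,\tilde r)$ either belongs to $F$ or fails to be mutually stable with some $\tilde x\in F$. If $\tilde X_{\infty,\tilde r}$ is a maximal self-stable subset of $Seq(X,\tilde r)$, then $d_{\tilde r}$ is a pseudometric on it; its metric identification $\Omega^X_{\infty,\tilde r}$, i.e. the set of equivalence classes of $\tilde X_{\infty,\tilde r}$ under the relation $d_{\tilde r}(\tilde x,\tilde y)=0$ with the induced metric, is called an asymptotically pretangent space to $X$ with respect to $\tilde r$ (there is one for each maximal self-stable set). *)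

(* Defs.v *)
From HB Require Import structures.
From mathcomp Require Import all_boot all_order all_algebra.
From mathcomp Require Import all_classical all_reals all_analysis.

Set Implicit Arguments.
Unset Strict Implicit.
Unset Printing Implicit Defensive.

Import Order.TTheory GRing.Theory Num.Theory.
Import numFieldNormedType.Exports.

Local Open Scope classical_set_scope.
Local Open Scope ring_scope.

Section Definitions.
Context {R : realType} {X : metricType R}.
Implicit Types (p : X) (r : nat -> R) (x y z : nat -> X) (F : set (nat -> X)).

Definition metric_bounded (A : set X) : Prop :=
  exists M : R, forall a b, A a -> A b -> mdist a b <= M.

Definition scaling_seq r : Prop := (forall n, 0 < r n) /\ r @ \oo --> +oo.

Definition scaled_dist r x y : nat -> R := fun n => mdist (x n) (y n) / r n.

(* [cvgn] is convergence in [R], so the limit is required to be finite. *)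
Definition mutually_stable r x y : Prop := cvgn (scaled_dist r x y).

(* The value d_r(x, y), meaningful only when [mutually_stable r x y]; the
   assertion d_r(x, y) = c, which includes the existence of the limit, is
   [scaled_dist r x y @ \oo --> c]. *)
Definition stable_dist r x y : R := limn (scaled_dist r x y).

(* Taking the constant sequence [p] as second argument gives d(x_n, p) / r_n. *)
Definition Seq p r : set (nat -> X) :=
  [set x | cvgn (scaled_dist r x (fun=> p))].

(* The value of the limit of d(x_n, p) / r_n, meaningful on [Seq p r]. *)
Definition stable_norm p r x : R := limn (scaled_dist r x (fun=> p)).

Definition self_stable p r F : Prop :=
  F `<=` Seq p r /\ forall x y, F x -> F y -> mutually_stable r x y.

Definition maximal_self_stable p r F : Prop :=
  self_stable p r F /\
  forall y, Seq p r y -> F y \/ exists2 x, F x & ~ mutually_stable r x y.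

Definition X0 p r : set (nat -> X) :=
  [set z | scaled_dist r z (fun=> p) @ \oo --> (0 : R)].

Definition Xinfty p : set (nat -> X) :=
  [set x | (fun n => mdist (x n) p) @ \oo --> +oo].

Definition subseq_map (s : nat -> nat) x : nat -> X := x \o s.

Definition stable_class r F x : set (nat -> X) :=
  [set y | F y /\ scaled_dist r x y @ \oo --> (0 : R)].

(* The proof arguments are what makes the distance below a metric. *)
Definition pretangent p r (hr : scaling_seq r) F
    (hF : maximal_self_stable p r F) : Type :=
  [set stable_class r F x | x in F].

End Definitions.

Section PretangentMetric.
Context {R : realType} {X : metricType R}.
Variables (p : X) (r : nat -> R) (hr : scaling_seq r).
Variables (F : set (nat -> X)) (hF : maximal_self_stable p r F).
Implicit Types (x y z : nat -> X) (C D E : pretangent hr hF).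

HB.instance Definition _ := Choice.copy (pretangent hr hF)
  (set_type [set stable_class r F x | x in F]).

Lemma pretangent_subproof C :
  exists2 x, F x & stable_class r F x = set_val C.
Proof. by have := set_valP C. Qed.

Definition pretangent_repr C : nat -> X := projT1 (cid2 (pretangent_subproof C)).

Definition pretangent_dist C D : R :=
  stable_dist r (pretangent_repr C) (pretangent_repr D).

Let reprF C : F (pretangent_repr C).
Proof. by rewrite /pretangent_repr; case: cid2. Qed.

Let reprE C : stable_class r F (pretangent_repr C) = set_val C.
Proof. by rewrite /pretangent_repr; case: cid2. Qed.

Let Fcvg x y : F x -> F y -> scaled_dist r x y @ \oo --> stable_dist r x y.
Proof. by move=> Fx Fy; case: hF => -[_ h] _; exact: h. Qed.

Let distC x y : stable_dist r x y = stable_dist r y x.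
Proof.
by congr (limn _); apply/funext => n; rewrite /scaled_dist metric_sym.
Qed.

Let distxx x : stable_dist r x x = 0.
Proof.
rewrite /stable_dist (_ : scaled_dist r x x = fun=> 0) ?lim_cst//.
by apply/funext => n; rewrite /scaled_dist mdistxx mul0r.
Qed.

Let dist_triangle y x z : F x -> F y -> F z ->
  stable_dist r x z <= stable_dist r x y + stable_dist r y z.
Proof.
move=> Fx Fy Fz; apply: ler_cvg_to (Fcvg Fx Fz)
  (cvgD (Fcvg Fx Fy) (Fcvg Fy Fz)) _.
near=> n; rewrite /scaled_dist /= -mulrDl ler_wpM2r//.
  by rewrite invr_ge0 ltW//; case: hr.
exact: metric_triangle.
Unshelve. all: by end_near. Qed.

Let dist_ge0 x y : F x -> F y -> 0 <= stable_dist r x y.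
Proof.
move=> Fx Fy; have := dist_triangle Fx Fy Fx.
by rewrite distxx (distC y) -mulr2n pmulrn_lge0.
Qed.

Let classE x y : F x -> F y -> stable_class r F x y <-> stable_dist r x y = 0.
Proof.
move=> Fx Fy; split=> [[_ xy0]|e].
  by rewrite /stable_dist; apply/cvg_lim: xy0.
split => //.
by rewrite -e; exact: Fcvg.
Qed.

Lemma pretangent_distxx C : pretangent_dist C C = 0.
Proof. exact: distxx. Qed.

Lemma pretangent_dist_sym C D : pretangent_dist C D = pretangent_dist D C.
Proof. exact: distC. Qed.

Lemma pretangent_dist_triangle D C E :
  pretangent_dist C E <= pretangent_dist C D + pretangent_dist D E.
Proof. exact: dist_triangle. Qed.

Lemma pretangent_dist_positivity C D : pretangent_dist C D = 0 -> C = D.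
Proof.
move=> CD0; apply: val_inj; rewrite /= -[LHS]reprE -[RHS]reprE.
have sub x y : F x -> F y -> stable_dist r x y = 0 ->
    stable_class r F x `<=` stable_class r F y.
  move=> Fx Fy xy0 z xz; have Fz : F z by case: xz.
  apply/classE => //; move/classE : xz => /(_ Fx Fz) xz0.
  apply/eqP; rewrite eq_le dist_ge0// andbT.
  by have := dist_triangle Fy Fx Fz; rewrite xz0 (distC y x) xy0 addr0.
by apply/seteqP; split; apply: sub => //; rewrite distC.
Qed.

HB.instance Definition _ := isMetric.Build R (pretangent hr hF)
  pretangent_distxx pretangent_dist_positivity
  pretangent_dist_sym pretangent_dist_triangle.

(* The metric of [pretangent hr hF] is the one induced by d_r. *)
Lemma pretangent_mdistE C D x y : set_val C x -> set_val D y ->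
  mdist C D = stable_dist r x y.
Proof.
rewrite -!reprE => Cx Dy; have [Fx _] := Cx; have [Fy _] := Dy.
move/classE : Cx => /(_ (reprF C) Fx) Cx.
move/classE : Dy => /(_ (reprF D) Fy) Dy.
change (pretangent_dist C D = stable_dist r x y).
rewrite /pretangent_dist; apply/eqP; rewrite eq_le; apply/andP; split.
  have := dist_triangle (reprF C) Fx (reprF D).
  have := dist_triangle Fx Fy (reprF D).
  by rewrite Cx (distC y (pretangent_repr D)) Dy addr0 add0r => h /le_trans; apply.
have := dist_triangle Fx (reprF C) Fy.
have := dist_triangle (reprF C) (reprF D) Fy.
by rewrite (distC x (pretangent_repr C)) Cx Dy addr0 add0r => h /le_trans; apply.
Qed.

End PretangentMetric.

(* Main.v *)
(* If d(x_n, x'_n) / r_n tends to 0, then by the triangle inequality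
   d(x_n, y_n) / r_n and d(x'_n, y_n) / r_n have the same limit. Hence the
   sequences of X0 are interchangeable with the constant sequence p. *)
Require Import Defs.
From HB Require Import structures.
From mathcomp Require Import all_boot all_order all_algebra.
From mathcomp Require Import all_classical all_reals all_analysis.
From mathcomp Require unstable.

Set Implicit Arguments.
Unset Strict Implicit.
Unset Printing Implicit Defensive.

Import Order.TTheory GRing.Theory Num.Theory.
Import numFieldNormedType.Exports.

Local Open Scope classical_set_scope.
Local Open Scope ring_scope.

Section ScaledDist.
Context {R : realType} {X : metricType R}.
Implicit Types (p : X) (r : nat -> R) (x y z : nat -> X) (F : set (nat -> X)).

Lemma scaled_distC r x y : scaled_dist r x y = scaled_dist r y x.
Proof. by apply/funext => n; rewrite /scaled_dist metric_sym. Qed.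

Lemma scaled_dist_ge0 r x y n : scaling_seq r -> 0 <= scaled_dist r x y n.
Proof. by case=> r0 _; rewrite divr_ge0 ?mdist_ge0// ltW. Qed.

Lemma mdist_distl (a b c : X) : `|mdist a c - mdist b c| <= mdist a b.
Proof.
rewrite ler_distl lerBlDr [mdist b c + _]addrC metric_triangle andbT.
by rewrite (metric_sym a b) addrC metric_triangle.
Qed.

Lemma cvg_scaled_dist r x x' y (l : R) : scaling_seq r ->
  scaled_dist r x x' @ \oo --> (0 : R) ->
  scaled_dist r x y @ \oo --> l -> scaled_dist r x' y @ \oo --> l.
Proof.
move=> [r0 _] xx' xy.
suff : (scaled_dist r x y - scaled_dist r x' y) @ \oo --> (0 : R).
  move=> h; rewrite -[l]subr0.
  rewrite (_ : scaled_dist r x' y =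
    scaled_dist r x y - (scaled_dist r x y - scaled_dist r x' y)).
    exact: cvgB xy h.
  by rewrite subKr.
apply/norm_cvg0P; apply: squeeze_cvgr (cvg_cst 0) xx'.
near=> n; have rV0 : 0 <= (r n)^-1 by rewrite invr_ge0 ltW.
rewrite normr_ge0/= /scaled_dist !fctE -mulrBl normrM (ger0_norm rV0).
by rewrite ler_wpM2r// mdist_distl.
Unshelve. all: by end_near. Qed.

Lemma cst_X0 p r : X0 p r (fun=> p).
Proof.
rewrite /X0 /= (_ : scaled_dist _ _ _ = fun=> 0); first exact: cvg_cst.
by apply/funext => n; rewrite /scaled_dist mdistxx mul0r.
Qed.

Lemma X0_subset_Seq p r : X0 p r `<=` Seq p r.
Proof. by move=> z z0; apply/cvg_ex; exists 0. Qed.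

(** By the triangle inequality through [x 0], the numerators d(x_n, p) stay below the constant
    [M + mdist (x 0) p], while [r] diverges. *)
Lemma bounded_X0 p r x : scaling_seq r -> metric_bounded (range x) -> X0 p r x.
Proof.
move=> hr [M xM]; have [r0 roo] := hr.
have Mr : (fun n => (M + mdist (x 0%N) p) * (r n)^-1) @ \oo --> (0 : R).
  rewrite -(mulr0 (M + mdist (x 0%N) p)); apply: cvgMr.
  by apply/gtr0_cvgV0 => //; near=> n.
apply: squeeze_cvgr (cvg_cst 0) Mr.
near=> n; have rV0 : 0 <= (r n)^-1 by rewrite invr_ge0 ltW.
rewrite scaled_dist_ge0//= ler_wpM2r//.
apply: le_trans (metric_triangle _ (x 0%N) _) _.
by rewrite lerD2r; apply: xM; [exists n|exists 0%N].
Unshelve. all: by end_near. Qed.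

Lemma X0_cvg_scaled_distE p r x z (l : R) : scaling_seq r -> X0 p r z ->
  scaled_dist r x (fun=> p) @ \oo --> l <-> scaled_dist r x z @ \oo --> l.
Proof.
(* With [x] moved to the second slot, each direction exchanges [z] and the constant [p] in the first
   one. *)
move=> hr z0; rewrite !(scaled_distC _ x).
split; apply: cvg_scaled_dist => //.
by rewrite scaled_distC.
Qed.

Lemma X0_mutually_stable p r x z : scaling_seq r -> X0 p r z ->
  Seq p r x <-> mutually_stable r x z.
Proof.
move=> hr z0; rewrite /Seq /mutually_stable /=.
by split=> /cvg_ex[l] xl; apply/cvg_ex; exists l;
  apply/(X0_cvg_scaled_distE _ _ hr z0).
Qed.

(** A pair with a member in [X0 p r] is stable because the other member lies in [Seq p r]; only
    pairs inside [F] call on the self-stability of [F]. *)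
Lemma self_stable_X0U p r F : scaling_seq r ->
  self_stable p r F -> self_stable p r (X0 p r `|` F).
Proof.
move=> hr [FS Fst].
have US : X0 p r `|` F `<=` Seq p r.
  by rewrite subUset; split=> //; exact: X0_subset_Seq.
split=> // x y Ux [y0|Fy].
  exact: (X0_mutually_stable x hr y0).1 (US _ Ux).
case: Ux => [x0|Fx]; last exact: Fst.
rewrite /mutually_stable scaled_distC.
exact: (X0_mutually_stable y hr x0).1 (FS _ Fy).
Qed.

(** Maximality could exclude [z] only through some [x] in [F] not stable with it, but such an [x]
    lies in [Seq p r]. *)
Lemma X0_sub_maximal p r F : scaling_seq r ->
  maximal_self_stable p r F -> X0 p r `<=` F.
Proof.
move=> hr [[FS _] Fmax] z z0.
have [//|[x Fx]] := Fmax z (X0_subset_Seq z0).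
by case; exact: (X0_mutually_stable x hr z0).1 (FS _ Fx).
Qed.

(** This exhibits [X0 p r] as a point of the pretangent space: the class of the constant sequence
    [p]. *)
Lemma stable_class_cst p r F : scaling_seq r ->
  maximal_self_stable p r F -> stable_class r F (fun=> p) = X0 p r.
Proof.
move=> hr hF; apply/seteqP; split=> [y [_]|y y0].
  by rewrite scaled_distC.
by split; [exact: X0_sub_maximal y0|rewrite scaled_distC].
Qed.

(** If all points were within [M] of [p], any two would be within [M + M] of each other. *)
Lemma unbounded_far p (M : R) :
  ~ metric_bounded [set: X] -> exists a : X, M <= mdist a p.
Proof.
apply: contra_notP => /forallNP h; exists (M + M) => a b _ _.
have lt_M c : mdist c p <= M by rewrite leNgt; apply/negP => /ltW; exact: h.
by apply: le_trans (metric_triangle a p b) _; rewrite lerD// metric_sym.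
Qed.

(* With d(a_k, p) >= k, take z_n = a_(k n), where k n is the largest k <= n such
   that k * d(a_k, p) <= r_n: the divergence of r makes k n tend to infinity,
   and d(z_n, p) / r_n <= 1 / k n. *)
Lemma X0_Xinfty_nonempty p r : ~ metric_bounded [set: X] -> scaling_seq r ->
  X0 p r `&` Xinfty p !=set0.
Proof.
move=> hX hr; have [r0 roo] := hr.
have /choice[a a_far] : forall k : nat, exists a : X, k%:R <= mdist a p.
  by move=> k; exact: unbounded_far.
pose P n k := (k <= n)%N && (k%:R * mdist (a k) p <= r n).
have /choice[k kP] : forall n, exists k, P n k /\ forall j, P n j -> (j <= k)%N.
  (* The index 0 always qualifies because [r n] is positive, and the cap [k <= n] guarantees a
     largest one. *)
  move=> n; have exP : exists k, P n k by exists 0%N; rewrite /P mul0r ltW.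
  have ubP j : P n j -> (j <= n)%N by case/andP.
  by have [k Pk kmax] := ex_maxnP exP ubP; exists k.
have koo : (fun n => (k n)%:R : R) @ \oo --> +oo.
  apply/cvgryPge => A; near=> n.
  (* A fixed natural number above [A] satisfies [P n] once [n] and [r n] are large, so the maximal
     [k n] dominates it. *)
  apply: le_trans (ltW (real_truncnS_gt (num_real A))) _.
  rewrite ler_nat; apply: (kP n).2; apply/andP; split.
    by near: n; exact: nbhs_infty_ge.
  by near: n; exact: (cvgryPge _).1 roo _.
exists (a \o k); split; last first.
  apply: ger_cvgy koo; near=> n; exact: a_far.
have k0 : \forall n \near \oo, 0 < (k n)%:R :> R by exact: (cvgryPgt _).1 koo 0.
have kV : (fun n => ((k n)%:R : R)^-1) @ \oo --> (0 : R).
  exact/(gtr0_cvgV0 k0).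
apply: squeeze_cvgr (cvg_cst 0) kV.
near=> n; rewrite scaled_dist_ge0//= /scaled_dist ler_pdivrMr//.
have kn0 : 0 < (k n)%:R :> R by near: n.
by rewrite ler_pdivlMl//; case/andP: (kP n).1.
Unshelve. all: by end_near. Qed.

(** Strict monotonicity on the naturals forces [n <= s n]. *)
Lemma cvg_increasing (s : nat -> nat) :
  {homo s : i j / (i < j)%N} -> s @ \oo --> \oo.
Proof.
move=> sS; apply/cvgnyPge => N; near=> n.
apply: leq_trans (unstable.mono_leq_infl (leq_mono sS) n).
by near: n; exact: nbhs_infty_ge.
Unshelve. all: by end_near. Qed.

(* A sequence of X0 p (r \o s) extends to one of X0 p r by the value p off the
   range of s. *)
Lemma subseq_map_X0 p r (s : nat -> nat) : {homo s : i j / (i < j)%N} ->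
  [set subseq_map s x | x in X0 p r] = X0 p (r \o s).
Proof.
move=> sS; have s_inj : injective s by exact: incn_inj (leq_mono sS).
apply/seteqP; split=> [_ [x x0 <-]|w w0].
  exact: cvg_comp (cvg_increasing sS) x0.
have /choice[x xP] : forall n, exists a : X,
    (forall k, s k = n -> a = w k) /\ ((forall k, s k <> n) -> a = p).
  move=> n; have [[k skn]|/forallNP ns] := pselect (exists k, s k = n).
    exists (w k); split=> [j sj|/(_ k)//].
    by congr (w _); apply: s_inj; rewrite skn.
  by exists p; split=> // k /ns.
exists x; last by apply/funext => k; exact: (xP (s k)).1.
apply/cvgr0Pnorm_lt => e e0.
have [N _ wN] := (cvgr0Pnorm_lt _).1 w0 e e0.
(* Beyond [s N], an index [n = s k] has [N <= k] because [s] reflects the order; off the range of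
   [s] the term is 0. *)
exists (s N) => // n /= sNn.
have [[k skn]|/forallNP ns] := pselect (exists k, s k = n).
  have : (N <= k)%N by rewrite -(leq_mono sS) skn.
  by move=> /wN; rewrite /scaled_dist /= ((xP n).1 _ skn) skn.
by rewrite /scaled_dist (xP n).2// mdistxx mul0r normr0.
Qed.

End ScaledDist.

Theorem proposition4p3 (R : realType) (X : metricType R)
    (hX : ~ metric_bounded [set: X]) (p : X)
    (r : nat -> R) (hr : scaling_seq r) :
  (* (i) *)
  (X0 p r `<=` Seq p r /\
   (forall x : nat -> X, metric_bounded (range x) -> X0 p r x)) /\
  (* (ii) *)
  (X0 p r `&` Xinfty p !=set0) /\
  (* (iii) *)
  (forall z y : nat -> X, X0 p r z ->
     scaled_dist r z y @ \oo --> (0 : R) -> X0 p r y) /\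
  (* (iv) *)
  (forall F : set (nat -> X), self_stable p r F ->
     self_stable p r (X0 p r `|` F)) /\
  (* (v) *)
  self_stable p r (X0 p r) /\
  (* (vi) *)
  (forall F : set (nat -> X), maximal_self_stable p r F -> X0 p r `<=` F) /\
  (* (vii) *)
  (forall z x : nat -> X, X0 p r z ->
     (Seq p r x <-> mutually_stable r x z)) /\
  (* (viii) *)
  (forall x z : nat -> X, Seq p r x -> X0 p r z ->
     mutually_stable r x z /\ stable_norm p r x = stable_dist r x z) /\
  (* (ix) *)
  (forall (F : set (nat -> X)) (hF : maximal_self_stable p r F),
     exists w : pretangent hr hF, set_val w = X0 p r) /\
  (* (x) *)
  (forall s : nat -> nat, {homo s : i j / (i < j)%N} ->
     [set subseq_map s x | x in X0 p r] = X0 p (r \o s)).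
Proof.
split; first by split=> [|x]; [exact: X0_subset_Seq|exact: bounded_X0].
split; first exact: X0_Xinfty_nonempty.
split; first by move=> z y z0 zy; exact: cvg_scaled_dist zy z0.
split; first by move=> F; exact: self_stable_X0U.
split.
  (* The empty set is vacuously self-stable, so (iv) applies with [F] empty. *)
  by rewrite -[X0 p r]setU0; apply: self_stable_X0U => //; split.
split; first by move=> F; exact: X0_sub_maximal.
split; first by move=> z x; exact: X0_mutually_stable.
split.
  move=> x z xS z0; split; first exact: (X0_mutually_stable x hr z0).1 xS.
  by apply/esym/cvg_lim => //; exact: (X0_cvg_scaled_distE _ _ hr z0).1 xS.
split=> [F hF|s]; last exact: subseq_map_X0.
have X0P : [set stable_class r F x | x in F] (X0 p r).
  exists (fun=> p); last exact: stable_class_cst.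
  exact: X0_sub_maximal (cst_X0 p r).
by exists (SigSub (mem_set X0P)).
Qed.
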